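(* Let $\mathcal{P}_v$ be the set of vectors ($\Re$-equivalence classes of arrows) of an arrow space $\mathcal{P}_A$ satisfying Axioms 1, 2, 4, 5 stated in the context. The addition $+_V$ is commutative: for any $[\overrightarrow{AB}],[\overrightarrow{CD}]\in\mathcal{P}_v$, $[\overrightarrow{AB}]+_V[\overrightarrow{CD}]=[\overrightarrow{CD}]+_V[\overrightarrow{AB}]$.
   Context: Let $\mathcal{P}$ be an infinite set whose elements are called points. An arrow is an ordered pair of points $\overrightarrow{AB}=(A,B)$ (tail $A$, head $B$; $A=B$ is allowed). The arrow space $\mathcal{P}_A$ is the set of all arrows; two arrows are equal iff they have the same tail and the same head. Negation: $-\overrightarrow{AB}=\overrightarrow{BA}$. Arrow addition is the partial operation $\overrightarrow{AB}+_A\overrightarrow{BC}=\overrightarrow{AC}$, defined exactly when the head of the first arrow equals the tail of the second. Axiom 1: there is a given map (arrow pre-inner product) $\langle -,-\rangle_A:\mathcal{P}_A\times\mathcal{P}_A\to\mathbb{R}$ such that for all points: $\langle\overrightarrow{AB},\overrightarrow{AB}\rangle_A\ge 0$, with equality iff $A=B$; $\langle\overrightarrow{AB},\overrightarrow{CD}\rangle_A=\langle\overrightarrow{CD},\overrightarrow{AB}\rangle_A$; $\langle\overrightarrow{AB}+_A\overrightarrow{BC},\overrightarrow{LM}\rangle_A=\langle\overrightarrow{AB},\overrightarrow{LM}\rangle_A+\langle\overrightarrow{BC},\overrightarrow{LM}\rangle_A$; $\langle-\overrightarrow{AB},\overrightarrow{CD}\rangle_A=-\langle\overrightarrow{AB},\overrightarrow{CD}\rangle_A$.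 Measure: $\|\overrightarrow{AB}\|_A=\sqrt{\langle\overrightarrow{AB},\overrightarrow{AB}\rangle_A}$. Scalar multiplication: for $t\in\mathbb{R}$, if $A=B$ or $t=0$ then $(t)\overrightarrow{AB}=\overrightarrow{AA}$. If $A\ne B$ and $t\neq0$ then $(t)\overrightarrow{AB}=\overrightarrow{AD}$, where $D\in\mathcal{P}$ is a point (assumed to exist) with $\|\overrightarrow{AD}\|_A=|t|\,\|\overrightarrow{AB}\|_A$ and $\langle\overrightarrow{AB},\overrightarrow{AD}\rangle_A=\|\overrightarrow{AB}\|_A\|\overrightarrow{AD}\|_A$ if $t>0$, $=-\|\overrightarrow{AB}\|_A\|\overrightarrow{AD}\|_A$ if $t<0$. Axiom 2: $\langle(t)\overrightarrow{AB},\overrightarrow{CD}\rangle_A=t\langle\overrightarrow{AB},\overrightarrow{CD}\rangle_A$ for all arrows and all $t\in\mathbb{R}$. Relation $\Re$ on $\mathcal{P}_A$: $\overrightarrow{AB}\;\Re\;\overrightarrow{CD}$ iff either $A=B$ and $C=D$, or ($A\ne B$, $C\neq D$ and) $\|\overrightarrow{AB}\|_A=\|\overrightarrow{CD}\|_A$ and $\frac{\langle\overrightarrow{AB},\overrightarrow{CD}\rangle_A}{\|\overrightarrow{AB}\|_A\|\overrightarrow{CD}\|_A}=1$. Axiom 4: if $\overrightarrow{AB}\;\Re\;\overrightarrow{CD}$ and $\overrightarrow{EF}\;\Re\;\overrightarrow{GH}$, then $\langle\overrightarrow{AB},\overrightarrow{EF}\rangle_A=\langle\overrightarrow{CD},\overrightarrow{GH}\rangle_A$.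 (Then $\Re$ is an equivalence relation.) Axiom 5: for $A\neq B$ and any point $P$, there is a unique point $K$ with $\overrightarrow{AB}\;\Re\;\overrightarrow{PK}$ and a unique point $K'$ with $\overrightarrow{AB}\;\Re\;\overrightarrow{K'P}$. (For $A=B$ the same holds with $K=K'=P$.) Vectors: $\mathcal{P}_v$ is the set of $\Re$-equivalence classes $[\overrightarrow{AB}]$. Vector addition: given $[\overrightarrow{AB}],[\overrightarrow{CD}]$, choose any point $P$, let $K,L$ be the unique points with $\overrightarrow{KP}\;\Re\;\overrightarrow{AB}$ and $\overrightarrow{PL}\;\Re\;\overrightarrow{CD}$, and set $[\overrightarrow{AB}]+_V[\overrightarrow{CD}]=[\overrightarrow{KP}+_A\overrightarrow{PL}]=[\overrightarrow{KL}]$; this is well defined (independent of $P$ and of the representatives). *)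

(* Defs.v *)
From HB Require Import structures.
From mathcomp Require Import all_boot all_order all_algebra.
From mathcomp Require Import all_classical all_reals.

Set Implicit Arguments.
Unset Strict Implicit.
Unset Printing Implicit Defensive.

Import Order.TTheory GRing.Theory Num.Theory.

Local Open Scope ring_scope.
Local Open Scope quotient_scope.

(* The arrow from A to B is the pair (A, B). *)
Definition arrow (P : Type) : Type := (P * P)%type.

Definition oppA (P : Type) (a : arrow P) : arrow P := (a.2, a.1).

(* Partial operation: None when the head of a is not the tail of b. *)
Definition addA (P : choiceType) (a b : arrow P) : option (arrow P) :=
  if a.2 == b.1 then Some (a.1, b.2) else None.

Definition normA (R : realType) (P : Type) (ip : arrow P -> arrow P -> R)
  (a : arrow P) : R := Num.sqrt (ip a a).

Definition simA (R : realType) (P : choiceType) (ip : arrow P -> arrow P -> R)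
    (a b : arrow P) : bool :=
  ((a.1 == a.2) && (b.1 == b.2)) ||
  [&& a.1 != a.2, b.1 != b.2, normA ip a == normA ip b
    & ip a b / (normA ip a * normA ip b) == 1].

Record arrowSpace (R : realType) := ArrowSpace {
  point :> choiceType;
  point_infinite : infinite_set [set: point];
  ipA : arrow point -> arrow point -> R;
  ipA_ge0 : forall a, 0 <= ipA a a;
  ipA_eq0 : forall a, ipA a a = 0 <-> a.1 = a.2;
  ipAC : forall a b, ipA a b = ipA b a;
  ipADl : forall a b c d, addA a b = Some c -> ipA c d = ipA a d + ipA b d;
  ipANl : forall a b, ipA (oppA a) b = - ipA a b;
  (* The head D of the scalar multiple is assumed to exist, so scalar
     multiplication is given as an operation subject to its specification. *)
  scaleA : R -> arrow point -> arrow point;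
  scaleA_triv : forall (t : R) (A B : point), A = B \/ t = 0 ->
    scaleA t (A, B) = (A, A);
  scaleA_spec : forall (t : R) (A B : point), A <> B -> t <> 0 ->
    exists D : point,
      [/\ scaleA t (A, B) = (A, D),
          normA ipA (A, D) = `|t| * normA ipA (A, B),
          0 < t -> ipA (A, B) (A, D) = normA ipA (A, B) * normA ipA (A, D)
        & t < 0 -> ipA (A, B) (A, D) = - (normA ipA (A, B) * normA ipA (A, D))];
  ipAZl : forall t a b, ipA (scaleA t a) b = t * ipA a b;
  ipA_sim : forall a b e f, simA ipA a b -> simA ipA e f -> ipA a e = ipA b f;
  sim_from : forall A B P : point, A <> B ->
    exists! K : point, simA ipA (A, B) (P, K);
  sim_to : forall A B P : point, A <> B ->
    exists! K : point, simA ipA (A, B) (K, P)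
}.

Definition sim (R : realType) (S : arrowSpace R) : rel (arrow S) :=
  simA (@ipA R S).

Lemma simP (R : realType) (S : arrowSpace R) (a b : arrow S) :
  reflect (ipA a b = ipA a a /\ ipA a b = ipA b b) (sim a b).
Proof.
have simaa (c : arrow S) : sim c c.
  rewrite /sim /simA; case: eqVneq => //= cN; rewrite eqxx /=.
  rewrite -expr2 /normA sqr_sqrtr ?ipA_ge0// divff//.
  by apply/eqP => /ipA_eq0 /eqP; rewrite (negPf cN).
apply: (iffP idP) => [ab|[e1 e2]].
  by split; [rewrite (ipA_sim (simaa a) ab)|rewrite (ipA_sim ab (simaa b))].
have eab : ipA a a = ipA b b by rewrite -e1.
rewrite /sim /simA /normA -eab eqxx /=.
have [ha|ha] := eqVneq a.1 a.2.
  have/ipA_eq0 h0 := ha; rewrite h0 in eab.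
  by have /ipA_eq0 -> := esym eab; rewrite eqxx.
have aa0 : ipA a a != 0 by apply/eqP => /ipA_eq0 /eqP; rewrite (negPf ha).
have -> : b.1 != b.2.
  by apply/eqP => /ipA_eq0 h0; rewrite eab h0 eqxx in aa0.
by rewrite /= e1 -expr2 sqr_sqrtr ?ipA_ge0// divff.
Qed.

Lemma sim_refl (R : realType) (S : arrowSpace R) : reflexive (@sim R S).
Proof. by move=> a; apply/simP. Qed.

Lemma sim_sym (R : realType) (S : arrowSpace R) : symmetric (@sim R S).
Proof.
by move=> a b; apply/simP/simP => -[e1 e2]; split; rewrite ipAC.
Qed.

Lemma sim_trans (R : realType) (S : arrowSpace R) : transitive (@sim R S).
Proof.
move=> b a c ab bc; apply/simP.
have -> := ipA_sim ab (sim_refl c); rewrite (ipA_sim ab ab).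
by have/simP[] := bc.
Qed.

Canonical sim_equiv (R : realType) (S : arrowSpace R) :=
  EquivRel (@sim R S) (@sim_refl R S) (@sim_sym R S) (@sim_trans R S).

Definition vector (R : realType) (S : arrowSpace R) : Type :=
  {eq_quot (sim_equiv S)}.

Definition vec (R : realType) (S : arrowSpace R) (a : arrow S) : vector S :=
  \pi_({eq_quot (sim_equiv S)}) a.

Definition vrepr (R : realType) (S : arrowSpace R) (v : vector S) : arrow S :=
  repr (v : {eq_quot (sim_equiv S)}).

Lemma vreprK (R : realType) (S : arrowSpace R) (v : vector S) :
  vec (vrepr v) = v.
Proof. exact: reprK. Qed.

Lemma eq_vec (R : realType) (S : arrowSpace R) (a b : arrow S) :
  vec a = vec b <-> sim a b.
Proof. by split=> [/eqmodP|ab]; last exact/eqmodP. Qed.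

Lemma sim_vrepr (R : realType) (S : arrowSpace R) (a : arrow S) :
  sim (vrepr (vec a)) a.
Proof. by apply/eq_vec; rewrite vreprK. Qed.

Lemma sim_pt (R : realType) (S : arrowSpace R) (A P : S) : sim (A, A) (P, P).
Proof. by rewrite /sim /simA /= !eqxx. Qed.

Lemma ex_tail (R : realType) (S : arrowSpace R) (a : arrow S) (P : S) :
  exists K : S, sim (K, P) a.
Proof.
case: a => A B; have [<-|/eqP AB] := eqVneq A B.
  by exists P; exact: sim_pt.
by have [K [AK _]] := sim_to P AB; exists K; rewrite sim_sym.
Qed.

Lemma ex_head (R : realType) (S : arrowSpace R) (a : arrow S) (P : S) :
  exists L : S, sim (P, L) a.
Proof.
case: a => A B; have [<-|/eqP AB] := eqVneq A B.
  by exists P; exact: sim_pt.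
by have [L [AL _]] := sim_from P AB; exists L; rewrite sim_sym.
Qed.

Definition tail_at (R : realType) (S : arrowSpace R) (v : vector S) (P : S) : S :=
  xchoose (ex_tail (vrepr v) P).

Definition head_at (R : realType) (S : arrowSpace R) (v : vector S) (P : S) : S :=
  xchoose (ex_head (vrepr v) P).

Definition base_point (R : realType) (S : arrowSpace R) : S :=
  sval (cid (infinite_setN0 (@point_infinite R S))).

(* The choices of base point and of representatives are immaterial: see addVE. *)
Definition addV (R : realType) (S : arrowSpace R) (u v : vector S) : vector S :=
  let P := base_point S in vec (tail_at u P, head_at v P).

Lemma sim_addA (R : realType) (S : arrowSpace R) (a b c a' b' c' : arrow S) :
  addA a b = Some c -> addA a' b' = Some c' ->
  sim a a' -> sim b b' -> sim c c'.
Proof.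
move=> ac ac' aa' bb'; apply/simP.
have D (x y x' y' : arrow S) : sim x x' -> sim y y' -> ipA x y = ipA x' y'.
  exact: ipA_sim.
have r := @sim_refl R S.
have e (x : arrow S) : ipA x c = ipA x a + ipA x b.
  by rewrite !(ipAC x) (ipADl _ ac).
have e' (x : arrow S) : ipA x c' = ipA x a' + ipA x b'.
  by rewrite !(ipAC x) (ipADl _ ac').
split; rewrite (ipADl c' ac) !e'.
  rewrite !(ipADl _ ac) !e.
  by rewrite -(D _ _ _ _ (r a) aa') -(D _ _ _ _ (r a) bb')
             -(D _ _ _ _ (r b) aa') -(D _ _ _ _ (r b) bb').
rewrite !(ipADl _ ac').
by rewrite (D _ _ _ _ aa' (r a')) (D _ _ _ _ aa' (r b'))
           (D _ _ _ _ bb' (r a')) (D _ _ _ _ bb' (r b')) addrACA.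
Qed.

Lemma addVE (R : realType) (S : arrowSpace R) (a b c : arrow S) (K P L : S) :
  sim (K, P) a -> sim (P, L) b -> addA (K, P) (P, L) = Some c ->
  addV (vec a) (vec b) = vec c.
Proof.
move=> Ka Lb KLc; apply/eq_vec.
set Q := base_point S.
apply: (@sim_addA _ _ (tail_at (vec a) Q, Q) (Q, head_at (vec b) Q) _
         (K, P) (P, L)) => //; first by rewrite /addA /= eqxx.
  apply: sim_trans (xchooseP (ex_tail _ _)) _.
  by apply: sim_trans (sim_vrepr _) _; rewrite sim_sym.
apply: sim_trans (xchooseP (ex_head _ _)) _.
by apply: sim_trans (sim_vrepr _) _; rewrite sim_sym.
Qed.

(* Main.v *)
Require Import Defs.
From mathcomp Require Import all_boot all_order all_algebra.
From mathcomp Require Import all_classical all_reals.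

(* For a fixed arrow x, the pre-inner product with x is constant on classes and
   additive, so the arrows representing u + v and v + u have the same
   pre-inner product with x; two arrows with this property for all x are
   related. *)

(** Axiom 4, with the second pair of related arrows taken to be [x] and itself. *)
Lemma sim_ipA (R : realType) (S : arrowSpace R) (a b x : arrow S) :
  sim a b -> ipA a x = ipA b x.
Proof. by move=> ab; apply: ipA_sim ab (sim_refl x). Qed.

(** The instances [x := a] and [x := b] already give the two equalities of [simP]. *)
Lemma ipA_ext_sim (R : realType) (S : arrowSpace R) (a b : arrow S) :
  (forall x, ipA a x = ipA b x) -> sim a b.
Proof. by move=> ab; apply/simP; rewrite -(ab b) ipAC -ab. Qed.

Lemma ipA_chasles (R : realType) (S : arrowSpace R) (A B C : S) (x : arrow S) :
  ipA (A, C) x = (ipA (A, B) x + ipA (B, C) x)%R.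
Proof. by apply: ipADl; rewrite /Defs.addA /= eqxx. Qed.

Lemma tail_atP (R : realType) (S : arrowSpace R) (v : vector S) (P : S) :
  sim (tail_at v P, P) (vrepr v).
Proof. exact: xchooseP (ex_tail (vrepr v) P). Qed.

Lemma head_atP (R : realType) (S : arrowSpace R) (v : vector S) (P : S) :
  sim (P, head_at v P) (vrepr v).
Proof. exact: xchooseP (ex_head (vrepr v) P). Qed.

Theorem theorem53 (R : realType) (S : arrowSpace R) (u v : vector S) :
  addV u v = addV v u.
Proof.
apply/eq_vec/ipA_ext_sim => x; set P := base_point S.
(* Both sums are formed at the same base point [P], so each arrow is split there. *)
rewrite (ipA_chasles _ _ (tail_at u P) P) (ipA_chasles _ _ (tail_at v P) P).
(* Passing to [vrepr u] and [vrepr v] leaves the same two real terms on each side, in opposite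
   order. *)
rewrite !(sim_ipA _ _ _ _ _ (tail_atP _ _ _ _)).
by rewrite !(sim_ipA _ _ _ _ _ (head_atP _ _ _ _)) GRing.addrC.
Qed.
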